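(* Let $S$ be a $(2,\omega)$-divisible Cu-semigroup satisfying (O5), (O6), (O7), and let $e\in S$ be full. Then there exists $w\in S_{\mathrm{soft}}$ such that $w\le e\le\infty w$, $\lambda(w)=\lambda(e)$ for all $\lambda\in F(S)$, and $\mathrm{rc}(S,e)=\mathrm{rc}(S_{\mathrm{soft}},w)$. If $S$ is moreover countably based and left-soft separative, then $\mathrm{rc}(S,e)=\mathrm{rc}(S_{\mathrm{soft}},\sigma(e))$, where $\sigma(e)$ is the largest strongly soft element below $e$.
   Context: A Cu-semigroup is a positively ordered commutative monoid satisfying (O1)–(O4): increasing sequences have suprema; each element is the supremum of a $\ll$-increasing sequence; $x'\ll x,y'\ll y\Rightarrow x'+y'\ll x+y$; suprema of increasing sequences are additive. $x\ll y$: whenever $y\le\sup z_n$ for increasing $(z_n)$, $x\le z_m$ for some $m$. (O5): if $x+y\le z$, $x'\ll x$, $y'\ll y$ then some $c$ has $y'\ll c$, $x'+c\le z\le x+c$. (O6): if $x'\ll x\le y+z$ then some $v,w$ have $v\le x,y$, $w\le x,z$, $x'\le v+w$. (O7): if $x'\ll x\le w$, $y'\ll y\le w$ then some $z$ has $x',y'\ll z\le w,x+y$. $\infty x=\sup nx$; $e$ is full if $\infty e$ is the largest element of $S$. Strongly soft: for each $x'\ll x$ there is $t$ with $x'+t\ll x$, $x'\ll\infty t$; $S_{\mathrm{soft}}$ = strongly soft elements, which here is a sub-Cu-semigroup. $(2,\omega)$-divisible: for $x'\ll x$ there is $y$ with $2y\le x$, $x'\le\infty y$. Countably based: some countable subset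 has every element as supremum of an increasing sequence from it. Left-soft separative: $y,t$ and $x\in S_{\mathrm{soft}}$ with $x+t\ll y+t$, $t\ll\infty x,\infty y$ imply $x\ll y$. $F(T)$: monoid morphisms $T\to[0,\infty]$ preserving order and suprema of increasing sequences. For a Cu-semigroup $T$, full $e\in T$ and $r>0$, $(T,e)$ satisfies (R1) for $r$ if for all $x,y\in T$, $\lambda(x)+r\lambda(e)\le\lambda(y)$ for all $\lambda\in F(T)$ implies $x\le y$; $\mathrm{rc}(T,e)$ is the infimum of all $r>0$ for which (R1) holds. *)

(* Defs.v *)
(* extended nonnegative reals [0,oo] are modelled by Coquelicot's Rbar. *)
From Stdlib Require Import Reals.
From Coquelicot Require Import Coquelicot.

Definition increasing {T : Type} (le : T -> T -> Prop) (s : nat -> T) : Prop :=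
  forall n, le (s n) (s (S n)).

Definition is_sup {T : Type} (le : T -> T -> Prop) (s : nat -> T) (z : T) : Prop :=
  (forall n, le (s n) z) /\ (forall u, (forall n, le (s n) u) -> le z u).

Definition way_below {T : Type} (le : T -> T -> Prop) (x y : T) : Prop :=
  forall (s : nat -> T) (z : T), increasing le s -> is_sup le s z -> le y z ->
    exists m, le x (s m).

Fixpoint nmul {T : Type} (add : T -> T -> T) (zero : T) (n : nat) (x : T) : T :=
  match n with O => zero | S n' => add (nmul add zero n' x) x end.

Record CuSemigroup := mkCu {
  car :> Type;
  le : car -> car -> Prop;
  add : car -> car -> car;
  zero : car;
  le_refl : forall x, le x x;
  le_trans : forall x y z, le x y -> le y z -> le x z;
  le_antisym : forall x y, le x y -> le y x -> x = y;
  add_assoc : forall x y z, add x (add y z) = add (add x y) z;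
  add_comm : forall x y, add x y = add y x;
  add_0 : forall x, add zero x = x;
  zero_le : forall x, le zero x;
  add_le : forall x y z, le x y -> le (add x z) (add y z);
  axO1 : forall s, increasing le s -> exists z, is_sup le s z;
  axO2 : forall x, exists s : nat -> car,
           (forall n, way_below le (s n) (s (S n))) /\ is_sup le s x;
  axO3 : forall x' x y' y, way_below le x' x -> way_below le y' y ->
           way_below le (add x' y') (add x y);
  axO4 : forall s t a b, increasing le s -> increasing le t ->
           is_sup le s a -> is_sup le t b ->
           is_sup le (fun n => add (s n) (t n)) (add a b)
}.

Arguments le {_}.
Arguments add {_}.
Arguments zero {_}.

Definition wb {S : CuSemigroup} (x y : S) : Prop := way_below (@le S) x y.

Definition is_infty {S : CuSemigroup} (t z : S) : Prop :=
  is_sup (@le S) (fun n => nmul (@add S) zero n t) z.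

Definition wb_infty {S : CuSemigroup} (x t : S) : Prop :=
  exists z, is_infty t z /\ wb x z.

Definition le_infty {S : CuSemigroup} (x t : S) : Prop :=
  exists z, is_infty t z /\ le x z.

Definition full {S : CuSemigroup} (e : S) : Prop :=
  exists z, is_infty e z /\ forall x : S, le x z.

Definition O5 (S : CuSemigroup) : Prop :=
  forall x' x y' y z : S, le (add x y) z -> wb x' x -> wb y' y ->
    exists c : S, wb y' c /\ le (add x' c) z /\ le z (add x c).

Definition O6 (S : CuSemigroup) : Prop :=
  forall x' x y z : S, wb x' x -> le x (add y z) ->
    exists v w : S, le v x /\ le v y /\ le w x /\ le w z /\ le x' (add v w).

Definition O7 (S : CuSemigroup) : Prop :=
  forall x' x y' y w : S, wb x' x -> le x w -> wb y' y -> le y w ->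
    exists z : S, wb x' z /\ wb y' z /\ le z w /\ le z (add x y).

Definition strongly_soft {S : CuSemigroup} (x : S) : Prop :=
  forall x', wb x' x -> exists t : S, wb (add x' t) x /\ wb_infty x' t.

Definition two_omega_divisible (S : CuSemigroup) : Prop :=
  forall x' x : S, wb x' x -> exists y : S, le (add y y) x /\ le_infty x' y.

Definition countably_based (S : CuSemigroup) : Prop :=
  exists d : nat -> S, forall x : S, exists k : nat -> nat,
    increasing (@le S) (fun n => d (k n)) /\ is_sup (@le S) (fun n => d (k n)) x.

Definition left_soft_separative (S : CuSemigroup) : Prop :=
  forall x y t : S, strongly_soft x -> wb (add x t) (add y t) ->
    wb_infty t x -> wb_infty t y -> wb x y.

Definition is_sup_in {S : CuSemigroup} (P : S -> Prop) (s : nat -> S) (z : S) : Prop :=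
  P z /\ (forall n, le (s n) z) /\ (forall u, P u -> (forall n, le (s n) u) -> le z u).

(** F(T) for the sub-Cu-semigroup T = P of S (P = everything gives F(S)):
    monoid morphisms T -> [0,oo] preserving order and suprema of increasing
    sequences.  Values of lam outside P are irrelevant. *)
Definition functional {S : CuSemigroup} (P : S -> Prop) (lam : S -> Rbar) : Prop :=
  lam zero = Finite 0 /\
  (forall x, P x -> Rbar_le (Finite 0) (lam x)) /\
  (forall x y, P x -> P y -> lam (add x y) = Rbar_plus (lam x) (lam y)) /\
  (forall x y, P x -> P y -> le x y -> Rbar_le (lam x) (lam y)) /\
  (forall (s : nat -> S) (z : S), (forall n, P (s n)) -> increasing (@le S) s ->
     is_sup_in P s z -> lam z = Sup_seq (fun n => lam (s n))).

Definition allS {S : CuSemigroup} : S -> Prop := fun _ => True.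

Definition R1 {S : CuSemigroup} (P : S -> Prop) (e : S) (r : R) : Prop :=
  forall x y : S, P x -> P y ->
    (forall lam, functional P lam ->
       Rbar_le (Rbar_plus (lam x) (Rbar_mult (Finite r) (lam e))) (lam y)) ->
    le x y.

(** rc(T, e) = inf { r > 0 | (R1) holds for r } in [0, oo] (inf of empty set = oo). *)
Definition rc {S : CuSemigroup} (P : S -> Prop) (e : S) : Rbar :=
  Glb_Rbar (fun r : R => 0 < r /\ R1 P e r).

(* Main.v *)
From Stdlib Require Import Reals Lra Lia Classical ClassicalEpsilon.
From Coquelicot Require Import Coquelicot.
Require Import Defs.

(** A strongly soft [w <= x] is built as the supremum of a chain of approximants [z] for which
    some remainder [r] satisfies [z + r <= x] and [z <= n r].  (2,omega)-divisibility and (O5)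
    make the remainder small, while (O6) and (O7) keep each new approximant in the ideal of its
    remainder; the outcome satisfies [x + w <= w + w].  Hence [w] and [x] have the same value
    under every functional, and [x |-> lam w] extends a functional [lam] on the strongly soft
    part to the whole semigroup.  Comparison is transferred from the soft part by adding a
    small soft element [v], with [(2 ^ j) v <= e], to each [x'] way below [x].

    For the largest strongly soft element, divisibility together with (O6) and (O7) shows that
    two elements have a common lower bound generating the intersection of their ideals.
    Removing a common lower bound of two gaps from [e] and cancelling it by left-soft
    separativity shows that the strongly soft elements below [e] are upward directed. *)

Declare Scope cu_scope.
Delimit Scope cu_scope with cu.
Notation "x + y" := (add x y) : cu_scope.
Notation "x <= y" := (le x y) : cu_scope.
Notation "x << y" := (wb x y) (at level 70, no associativity) : cu_scope.
Notation "n ** x" := (nmul add zero n x) (at level 40, left associativity) : cu_scope.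
Local Open Scope cu_scope.

(** Lets stage [n] of a chain take in the [n]-th term of a given sequence while the invariant [Q] is
    kept. *)
Lemma dependent_choice {A : Type} (Q : A -> Prop) (step : nat -> A -> A -> Prop) (a : A) :
  Q a -> (forall n z, Q z -> exists z', Q z' /\ step n z z') ->
  exists s : nat -> A, s O = a /\ (forall n, Q (s n)) /\ forall n, step n (s n) (s (S n)).
Proof.
  intros Ha Hstep.
  assert (Hc : forall n (z : sig Q), {z' : sig Q | step n (proj1_sig z) (proj1_sig z')}).
  { intros n [z Hz]. apply constructive_indefinite_description.
    destruct (Hstep n z Hz) as [z' [H1 H2]]. now exists (exist Q z' H1). }
  pose (s := fix s n := match n with
     | O => exist Q a Ha | S m => proj1_sig (Hc m (s m)) end).
  exists (fun n => proj1_sig (s n)); split; [reflexivity | split].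
  - intro n. exact (proj2_sig (s n)).
  - intro n. exact (proj2_sig (Hc n (s n))).
Qed.

(** * Order, addition, the way-below relation and ideals *)

Section Order.
Context {T : CuSemigroup}.
Implicit Types x y z d t : T.

Lemma add_le2 x x' y y' : x <= x' -> y <= y' -> x + y <= x' + y'.
Proof.
  intros H1 H2. apply le_trans with (x' + y); [now apply add_le|].
  rewrite !(add_comm _ x'). now apply add_le.
Qed.

Lemma add_zero_r x : x + zero = x.
Proof. rewrite add_comm. apply add_0. Qed.

Lemma le_addr x y : x <= x + y.
Proof.
  rewrite <- (add_zero_r x) at 1. apply add_le2; [apply le_refl | apply zero_le].
Qed.

Lemma le_addl x y : x <= y + x.
Proof. rewrite add_comm. apply le_addr. Qed.

Lemma add_swap (a b c d : T) : (a + b) + (c + d) = (a + c) + (b + d).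
Proof.
  rewrite <- !add_assoc. f_equal. rewrite !add_assoc. f_equal. apply add_comm.
Qed.

Lemma increasing_le (s : nat -> T) n m :
  increasing le s -> (n <= m)%nat -> s n <= s m.
Proof.
  intros Hs H. induction H; [apply le_refl | eapply le_trans; [eassumption | apply Hs]].
Qed.

Lemma wb_le x y : x << y -> x <= y.
Proof.
  intros H. destruct (H (fun _ => y) y) as [_ Hm]; auto using le_refl.
  - intro n. apply le_refl.
  - split; intros; [apply le_refl | apply (H0 O)].
Qed.

Lemma wb_mono x' x y y' : x' <= x -> x << y -> y <= y' -> x' << y'.
Proof.
  intros H1 H H2 s z Hs Hz Hle. destruct (H s z Hs Hz) as [m Hm].
  - eauto using le_trans.
  - exists m. eauto using le_trans.
Qed.

Lemma le_wb x' x y : x' <= x -> x << y -> x' << y.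
Proof. intros H1 H2. eapply wb_mono; eauto using le_refl. Qed.

Lemma wb_le_trans x y y' : x << y -> y <= y' -> x << y'.
Proof. intros H1 H2. eapply wb_mono; eauto using le_refl. Qed.

Lemma wb_trans x y z : x << y -> y << z -> x << z.
Proof. eauto using wb_le_trans, wb_le. Qed.

Lemma wb_zero x : zero << x.
Proof. intros s z _ _ _. exists O. apply zero_le. Qed.

Lemma wb_add x x' y y' : x' << x -> y' << y -> x' + y' << x + y.
Proof. apply axO3. Qed.

Lemma wb_seq_increasing (s : nat -> T) :
  (forall n, s n << s (S n)) -> increasing le s.
Proof. intros H n. apply wb_le, H. Qed.

(** Joins need not exist, but a late enough term of a way-below increasing sequence for [y] lies
    above both elements. *)
Lemma wb_join x1 x2 y : x1 << y -> x2 << y -> exists z, z << y /\ x1 << z /\ x2 << z.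
Proof.
  intros H1 H2. destruct (axO2 T y) as [s [Hs Hy]].
  pose proof (wb_seq_increasing s Hs) as Hi.
  destruct (H1 s y Hi Hy (le_refl _ _)) as [n1 Hn1].
  destruct (H2 s y Hi Hy (le_refl _ _)) as [n2 Hn2].
  set (n := Nat.max n1 n2).
  assert (L1 : x1 <= s n) by (eapply le_trans; [eassumption | apply increasing_le; auto; lia]).
  assert (L2 : x2 <= s n) by (eapply le_trans; [eassumption | apply increasing_le; auto; lia]).
  exists (s (S n)). repeat split.
  - eapply wb_le_trans; [apply Hs | apply Hy].
  - exact (le_wb _ _ _ L1 (Hs n)).
  - exact (le_wb _ _ _ L2 (Hs n)).
Qed.

Lemma wb_interp x y : x << y -> exists z, x << z /\ z << y.
Proof. intros H. destruct (wb_join x x y H H) as [z [? [? _]]]. eauto. Qed.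

Lemma le_of_wb x y : (forall x', x' << x -> x' <= y) -> x <= y.
Proof.
  intros H. destruct (axO2 T x) as [s [Hs Hx]]. apply Hx. intro n. apply H.
  eapply wb_le_trans; [apply Hs | apply Hx].
Qed.

(** By (O4) the termwise sums of approximating sequences for [x] and [y] have supremum [x + y], so
    some term passes [d]. *)
Lemma wb_add_split d x y :
  d << x + y -> exists x' y', x' << x /\ y' << y /\ d << x' + y'.
Proof.
  intros Hd. destruct (wb_interp _ _ Hd) as [d1 [Hd1 Hd2]].
  destruct (axO2 T x) as [s [Hs Hx]]. destruct (axO2 T y) as [t [Ht Hy]].
  pose proof (wb_seq_increasing s Hs) as Hsi. pose proof (wb_seq_increasing t Ht) as Hti.
  destruct (Hd2 (fun n => s n + t n) (x + y)) as [m Hm].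
  - intro n. now apply add_le2.
  - now apply axO4.
  - apply le_refl.
  - exists (s m), (t m). repeat split.
    + eapply wb_le_trans; [apply Hs | apply Hx].
    + eapply wb_le_trans; [apply Ht | apply Hy].
    + eapply wb_le_trans; eauto.
Qed.

Lemma nmul_le n x y : x <= y -> n ** x <= n ** y.
Proof. intros H. induction n; simpl; auto using le_refl, add_le2. Qed.

Lemma nmul_add n m x : (n + m)%nat ** x = n ** x + m ** x.
Proof.
  induction m; simpl.
  - now rewrite Nat.add_0_r, add_zero_r.
  - rewrite Nat.add_succ_r. simpl. now rewrite IHm, add_assoc.
Qed.

Lemma nmul_mul n m x : (n * m)%nat ** x = n ** (m ** x).
Proof.
  induction n; simpl; auto. now rewrite Nat.add_comm, nmul_add, IHn.
Qed.

Lemma nmul_one x : 1%nat ** x = x.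
Proof. apply add_0. Qed.

Lemma nmul_increasing x : increasing le (fun n => n ** x).
Proof. intro n. apply le_addr. Qed.

Lemma infty_exists x : exists z : T, is_infty x z.
Proof. apply axO1, nmul_increasing. Qed.

(** Each copy of [y] is approximated separately and [wb_join] merges the approximants into one. *)
Lemma wb_nmul d n y : d << n ** y -> exists y', y' << y /\ d <= n ** y'.
Proof.
  revert d. induction n as [|n IH]; simpl; intros d Hd.
  - exists zero. split; [apply wb_zero | now apply wb_le].
  - destruct (wb_add_split _ _ _ Hd) as [a [b [Ha [Hb Hab]]]].
    destruct (IH a Ha) as [y1 [Hy1 Hle]].
    destruct (wb_join _ _ _ Hy1 Hb) as [y' [Hy' [L1 L2]]].
    exists y'. split; auto. eapply le_trans; [now apply wb_le, Hab|].
    apply add_le2; [| now apply wb_le].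
    eapply le_trans; [exact Hle | now apply nmul_le, wb_le].
Qed.

(** A finitary substitute for lying below the supremum of the multiples of [y]; the two forms agree
    after an interpolation. *)
Definition dominated x y : Prop := exists n, x <= n ** y.

Lemma dominated_le x y : x <= y -> dominated x y.
Proof. exists 1%nat. now rewrite nmul_one. Qed.

Lemma dominated_trans x y z : dominated x y -> dominated y z -> dominated x z.
Proof.
  intros [n Hn] [m Hm]. exists (n * m)%nat. rewrite nmul_mul.
  eapply le_trans; [exact Hn | now apply nmul_le].
Qed.

Lemma dominated_mono x' x y y' : x' <= x -> dominated x y -> y <= y' -> dominated x' y'.
Proof. eauto using dominated_trans, dominated_le. Qed.

Lemma le_dominated x' x y : x' <= x -> dominated x y -> dominated x' y.
Proof. eauto using dominated_mono, le_refl. Qed.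

Lemma dominated_le_trans x y y' : dominated x y -> y <= y' -> dominated x y'.
Proof. eauto using dominated_mono, le_refl. Qed.

Lemma dominated_add x y z : dominated x z -> dominated y z -> dominated (x + y) z.
Proof. intros [n Hn] [m Hm]. exists (n + m)%nat. rewrite nmul_add. now apply add_le2. Qed.

Lemma dominated_wb d x y : d << x -> dominated x y -> exists y', y' << y /\ dominated d y'.
Proof.
  intros Hd [n Hn]. destruct (wb_nmul d n y) as [y' [H1 H2]].
  - eapply wb_le_trans; eauto.
  - exists y'. split; auto. now exists n.
Qed.

Lemma wb_infty_dominated x t : wb_infty x t -> dominated x t.
Proof.
  intros [z [Hz Hx]]. apply (Hx (fun n => n ** t) z); auto using nmul_increasing, le_refl.
Qed.

Lemma dominated_wb_infty x y t : x << y -> dominated y t -> wb_infty x t.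
Proof.
  intros Hx [n Hn]. destruct (infty_exists t) as [z Hz]. exists z. split; auto.
  eapply wb_le_trans; [exact Hx|]. eapply le_trans; [exact Hn | apply Hz].
Qed.

Lemma le_infty_dominated d x t : d << x -> le_infty x t -> dominated d t.
Proof.
  intros Hd [z [Hz Hx]]. apply wb_infty_dominated. exists z. split; auto.
  eapply wb_le_trans; eauto.
Qed.

Lemma full_dominated d x (e : T) : full e -> d << x -> dominated d e.
Proof.
  intros [z [Hz Hx]] Hd. apply (le_infty_dominated d x); auto. exists z. auto.
Qed.

(** * Strong softness and its closure properties *)

Lemma soft_gap x x' : strongly_soft x -> x' << x -> exists t, x' + t << x /\ dominated x' t.
Proof.
  intros Hx Hx'. destruct (Hx x' Hx') as [t [H1 H2]]. eauto using wb_infty_dominated.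
Qed.

Lemma soft_intro x :
  (forall x', x' << x -> exists t, x' + t << x /\ dominated x' t) -> strongly_soft x.
Proof.
  intros H x' Hx'. destruct (wb_interp _ _ Hx') as [x1 [H1 H2]].
  destruct (H x1 H2) as [t [H3 H4]]. exists t. split.
  - eapply le_wb; [| exact H3]. apply add_le. now apply wb_le.
  - eapply dominated_wb_infty; eauto.
Qed.

Lemma soft_zero : strongly_soft (@zero T).
Proof.
  apply soft_intro. intros x' Hx'. exists zero. rewrite add_zero_r. split; auto.
  apply dominated_le, wb_le, Hx'.
Qed.

Lemma soft_sup (s : nat -> T) z :
  increasing le s -> (forall n, strongly_soft (s n)) -> is_sup le s z -> strongly_soft z.
Proof.
  intros Hi Hs Hz. apply soft_intro. intros x' Hx'.
  destruct (wb_interp _ _ Hx') as [x1 [H1 H2]].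
  destruct (H2 s z Hi Hz (le_refl _ _)) as [m Hm].
  destruct (soft_gap (s m) x' (Hs m)) as [t [H3 H4]]; [eapply wb_le_trans; eauto|].
  exists t. split; auto. eapply wb_le_trans; [exact H3 | apply Hz].
Qed.

Lemma soft_add x y : strongly_soft x -> strongly_soft y -> strongly_soft (x + y).
Proof.
  intros Hx Hy. apply soft_intro. intros z Hz.
  destruct (wb_add_split _ _ _ Hz) as [x' [y' [Hx' [Hy' Hxy]]]].
  destruct (soft_gap x x' Hx Hx') as [t1 [A1 B1]].
  destruct (soft_gap y y' Hy Hy') as [t2 [A2 B2]].
  exists (t1 + t2). split.
  - eapply le_wb; [| exact (wb_add _ _ _ _ A1 A2)]. rewrite (add_swap x').
    apply add_le. now apply wb_le.
  - eapply le_dominated; [apply wb_le, Hxy|]. apply dominated_add.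
    + eapply dominated_le_trans; eauto using le_addr.
    + eapply dominated_le_trans; eauto using le_addl.
Qed.

(** The gap of [u] is taken over an element whose ideal already contains the chosen part of [x], so
    one gap serves both summands. *)
Lemma soft_add_absorb x u :
  strongly_soft u -> (forall x', x' << x -> dominated x' u) -> strongly_soft (x + u).
Proof.
  intros Hu Hx. apply soft_intro. intros z Hz.
  destruct (wb_add_split _ _ _ Hz) as [x' [u' [Hx' [Hu' Hxu]]]].
  destruct (wb_interp _ _ Hx') as [x1 [Hx1 Hx2]].
  destruct (dominated_wb x' x1 u Hx1 (Hx _ Hx2)) as [u1 [Hu1 Hd]].
  destruct (wb_join _ _ _ Hu' Hu1) as [u2 [Hu2 [L1 L2]]].
  destruct (soft_gap u u2 Hu Hu2) as [t [A B]].
  exists t. split.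
  - eapply le_wb; [| exact (wb_add _ _ _ _ Hx' A)]. rewrite add_assoc. apply add_le.
    eapply le_trans; [apply wb_le, Hxu|]. apply add_le2; [apply le_refl | now apply wb_le].
  - eapply le_dominated; [apply wb_le, Hxu|]. apply dominated_add.
    + eapply dominated_trans; [exact Hd|]. eapply le_dominated; [apply wb_le, L2 | exact B].
    + eapply le_dominated; [apply wb_le, L1 | exact B].
Qed.

End Order.

(** * Strongly soft elements below a given element *)

(* Approximants of strongly soft elements below [x]: the remainder [r] of [x] over [z1]
   generates an ideal containing [z1]. *)
Definition soft_approx {T : CuSemigroup} (x z : T) : Prop :=
  exists z1 r : T, z << z1 /\ z1 + r <= x /\ dominated z1 r.

Section SoftBelow.
Context {T : CuSemigroup}.
Hypothesis Hdiv : two_omega_divisible T.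
Hypothesis H5 : O5 T.
Hypothesis H6 : O6 T.
Hypothesis H7 : O7 T.
Implicit Types x y z d s u : T.

Lemma halving x' x : x' << x -> exists y, y + y <= x /\ dominated x' y.
Proof.
  intros H. destruct (wb_interp _ _ H) as [x1 [H1 H2]].
  destruct (Hdiv x1 x H2) as [y [Hy Hi]]. exists y. split; auto.
  eapply le_infty_dominated; eauto.
Qed.

(** Halving is iterated; an interpolation before each halving keeps [x'] in the ideal. *)
Lemma dyadic_division (j : nat) x' x :
  x' << x -> exists y, (2 ^ j)%nat ** y <= x /\ dominated x' y.
Proof.
  revert x' x. induction j as [|j IH]; intros x' x H.
  - exists x. simpl. rewrite add_0. split; [apply le_refl | apply dominated_le, wb_le, H].
  - destruct (wb_interp _ _ H) as [x1 [H1 H2]].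
    destruct (IH x1 x H2) as [y [Hy Hd]].
    destruct (dominated_wb _ _ _ H1 Hd) as [y' [Hy' Hd']].
    destruct (halving y' y Hy') as [v [Hv Hdv]].
    exists v. split; [| eapply dominated_trans; eauto].
    replace (2 ^ S j)%nat with (2 ^ j * 2)%nat by (simpl; lia).
    rewrite nmul_mul. eapply le_trans; [| exact Hy]. apply nmul_le.
    simpl. now rewrite add_0.
Qed.

(** The complement [c] from (O5) satisfies [x <= z3 + c] and [z3 <= n ** c], so [x <= S n ** c].
    Hence half of [c] still dominates everything way below [x]. *)
Lemma remainder_enlarge x z1 z2 r d :
  z1 << z2 -> z2 + r <= x -> dominated z2 r -> d << x ->
  exists p, z1 + (p + p) <= x /\ dominated d p.
Proof.
  intros Hz Hr Hdom Hd.
  destruct (wb_interp _ _ Hz) as [z3 [Hz13 Hz32]].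
  destruct (dominated_wb _ _ _ Hz32 Hdom) as [r' [Hr' [n Hn]]].
  destruct (H5 z1 z3 r' r x) as [c [Hc1 [Hc2 Hc3]]]; auto.
  { eapply le_trans; [| exact Hr]. now apply add_le, wb_le. }
  destruct (wb_nmul d (S n) c) as [c' [Hc' Hdc]].
  { eapply wb_le_trans; [exact Hd|]. eapply le_trans; [exact Hc3|]. simpl.
    apply add_le. eapply le_trans; [exact Hn|]. now apply nmul_le, wb_le. }
  destruct (halving c' c Hc') as [p [Hp Hdp]].
  exists p. split.
  - eapply le_trans; [| exact Hc2]. apply add_le2; auto using le_refl.
  - eapply dominated_trans; [| exact Hdp]. now exists (S n).
Qed.

Lemma soft_approx_le x z : soft_approx x z -> z <= x.
Proof.
  intros [z1 [r [H1 [H2 _]]]]. eapply le_trans; [apply wb_le, H1|].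
  eapply le_trans; [apply le_addr | exact H2].
Qed.

Lemma soft_approx_zero x : soft_approx x zero.
Proof.
  exists zero, zero. rewrite add_zero_r. repeat split; auto using wb_zero, zero_le.
  apply dominated_le, le_refl.
Qed.

Lemma soft_approx_of_soft x u z : strongly_soft u -> u <= x -> z << u -> soft_approx x z.
Proof.
  intros Hu Hx Hz. destruct (wb_interp _ _ Hz) as [z1 [H1 H2]].
  destruct (soft_gap u z1 Hu H2) as [t [H3 H4]]. exists z1, t. repeat split; auto.
  eapply le_trans; [apply wb_le, H3 | exact Hx].
Qed.

(* Split off a small [p1] from [x] with complement [f], so that [x <= p2 + f].  By (O6) the
   element [d] is covered by [a <= p2] and [b <= f] inside the ideal of [p1], and (O7) joins
   [z + a] and [b] inside [f] without leaving that ideal. *)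
Lemma soft_approx_step x z d :
  soft_approx x z -> d << x ->
  exists z' t, soft_approx x z' /\ z + t << z' /\ dominated z t /\ d + z <= z' + z'.
Proof.
  intros [zh [r [Hz [Hr Hdom]]]] Hd.
  destruct (wb_interp _ _ Hz) as [z1 [Hz1 Hz1h]].
  destruct (wb_interp _ _ Hz1) as [z0 [Hz0 Hz01]].
  assert (Hz1x : z1 << x).
  { eapply wb_le_trans; [exact Hz1h|]. eapply le_trans; [apply le_addr | exact Hr]. }
  destruct (wb_join _ _ _ Hd Hz1x) as [d1 [Hd1x [Hdd1 Hz1d1]]].
  destruct (wb_interp _ _ Hd1x) as [d2 [Hd12 Hd2x]].
  destruct (remainder_enlarge x z1 zh r d2) as [p [Hp Hdp]]; auto.
  destruct (dominated_wb _ _ _ Hd12 Hdp) as [p1 [Hp1 Hd1p1]].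
  destruct (wb_interp _ _ Hp1) as [p2 [Hp12 Hp2p]].
  destruct (wb_interp _ _ Hp2p) as [p3 [Hp23 Hp3p]].
  (* Of the two copies of [p], one is split off and the other stays inside [f] next to [z0], leaving
     room there for [z0 + a] and [z0 + p1]. *)
  destruct (H5 p1 p2 (p3 + z0) (p + z1) x) as [f [Hf1 [Hf2 Hf3]]].
  { eapply le_trans; [| exact Hp]. rewrite add_assoc, (add_comm _ z1). apply add_le2; auto using le_refl.
    now apply add_le, wb_le. }
  { exact Hp12. }
  { now apply wb_add. }
  apply wb_le in Hf1.
  destruct (wb_interp _ _ Hdd1) as [d0 [Hdd0 Hd01]].
  destruct (H6 d0 d1 p2 f) as [a [b [Ha1 [Ha2 [Hb1 [Hb2 Hab]]]]]]; auto.
  { eapply le_trans; [apply wb_le, Hd1x | exact Hf3]. }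
  destruct (wb_add_split d a b) as [a' [b' [Ha' [Hb' Hd']]]].
  { eapply wb_le_trans; eauto. }
  assert (Hzp1 : dominated z1 p1) by (eapply le_dominated; [apply wb_le, Hz1d1 | exact Hd1p1]).
  destruct (dominated_wb _ _ _ Hz1 Hzp1) as [p0 [Hp0 Hzp0]].
  (* Joining [z + p0] as well makes [p0] the gap between [z] and the next approximant. *)
  destruct (H7 (z + a') (z0 + a) (z + p0) (z0 + p1) f) as [g1 [Hg1 [Hg2 [Hg3 Hg4]]]].
  { now apply wb_add. }
  { eapply le_trans; [| exact Hf1]. rewrite add_comm. apply add_le.
    eapply le_trans; [exact Ha2 | now apply wb_le]. }
  { now apply wb_add. }
  { eapply le_trans; [| exact Hf1]. rewrite add_comm. apply add_le.
    apply wb_le. eapply wb_trans; eauto. }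
  destruct (wb_join _ _ _ Hg1 Hg2) as [g1' [Hg1' [L1 L2]]].
  destruct (H7 b' b g1' g1 f) as [g [Hgb [Hgg [Hgf Hgs]]]]; auto.
  destruct (wb_join _ _ _ Hgb Hgg) as [z' [Hz' [L3 L4]]].
  exists z', p0. repeat split; auto.
  - exists g, p1. repeat split; auto.
    + rewrite add_comm. eapply le_trans; [| exact Hf2].
      apply add_le2; auto using le_refl.
    + assert (Dz0 : dominated z0 p1) by (eapply le_dominated; [apply wb_le, Hz01 | exact Hzp1]).
      eapply le_dominated; [exact Hgs|]. apply dominated_add.
      * exact (le_dominated _ _ _ Hb1 Hd1p1).
      * eapply le_dominated; [exact Hg4|]. repeat apply dominated_add; auto.
        -- exact (le_dominated _ _ _ Ha1 Hd1p1).
        -- apply dominated_le, le_refl.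
  - eapply wb_trans; eauto.
  - eapply le_trans; [apply add_le, wb_le, Hd'|].
    rewrite (add_comm _ a'), <- add_assoc, (add_comm _ a').
    apply add_le2; [now apply wb_le|]. apply wb_le. eapply wb_trans; eauto.
Qed.

(* The condition [x + w <= w + w] is what makes [w] and [x] agree under every functional. *)
Lemma soft_below x z :
  soft_approx x z ->
  exists w, strongly_soft w /\ z <= w /\ w <= x /\ x + w <= w + w.
Proof.
  intros Hz. destruct (axO2 T x) as [xs [Hxs Hx]].
  destruct (dependent_choice (soft_approx x)
    (fun n z z' => (exists t, z + t << z' /\ dominated z t) /\ xs n + z <= z' + z') z Hz)
    as [s [Hs0 [HQ Hstep]]].
  { intros n y Hy. destruct (soft_approx_step x y (xs n) Hy) as [y' [t [A [B [C D]]]]].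
    - eapply wb_le_trans; [apply Hxs | apply Hx].
    - exists y'. split; [exact A | split; eauto]. }
  assert (Hi : increasing le s).
  { intro n. destruct (Hstep n) as [[t [A _]] _].
    eapply le_trans; [apply le_addr | apply wb_le, A]. }
  destruct (axO1 T s Hi) as [w Hw]. exists w. repeat split.
  (* Any [w'] way below [w] is below some [s m], and the gap built at stage [m] serves it. *)
  - apply soft_intro. intros w' Hw'. destruct (Hw' s w Hi Hw (le_refl _ _)) as [m Hm].
    destruct (Hstep m) as [[t [A B]] _]. exists t. split.
    + eapply wb_mono; [| exact A | apply Hw]. now apply add_le.
    + eapply le_dominated; eauto.
  - rewrite <- Hs0. apply Hw.
  - apply Hw. intro n. apply soft_approx_le, HQ.
  - assert (Hsup : is_sup le (fun n => xs n + s n) (x + w)).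
    { apply axO4; auto. now apply wb_seq_increasing. }
    apply Hsup. intro n. destruct (Hstep n) as [_ D]. eapply le_trans; [exact D|].
    apply add_le2; apply Hw.
Qed.

Lemma soft_below_exists x :
  exists w, strongly_soft w /\ w <= x /\ x + w <= w + w.
Proof.
  destruct (soft_below x zero (soft_approx_zero x)) as [w [A [_ B]]]. eauto.
Qed.

Lemma absorbing_dominates x w : x + w <= w + w -> dominated x w.
Proof.
  intros H. exists 2%nat. simpl. rewrite add_0. eapply le_trans; [apply le_addr | exact H].
Qed.

(** An ordinary interpolant [s1] is made soft by adding a soft [u] from its gap [t]; [u] generates
    the ideal of [t], which contains [s1]. *)
Lemma soft_interp s' s :
  strongly_soft s -> s' << s -> exists u, strongly_soft u /\ s' << u /\ u << s.
Proof.
  intros Hs Hs'. destruct (wb_interp _ _ Hs') as [s1 [H1 H2]].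
  destruct (soft_gap s s1 Hs H2) as [t [Ht Hd]].
  destruct (soft_below_exists t) as [u [Hu [Hut Habs]]].
  exists (s1 + u). repeat split.
  - apply soft_add_absorb; auto. intros x' Hx'.
    eapply le_dominated; [apply wb_le, Hx'|]. eapply dominated_trans; [exact Hd|].
    now apply absorbing_dominates.
  - eapply wb_le_trans; [exact H1 | apply le_addr].
  - eapply le_wb; [| exact Ht]. apply add_le2; auto using le_refl.
Qed.

(** Provides soft approximants, since a functional on the soft part preserves only suprema of soft
    sequences. *)
Lemma soft_approx_seq s :
  strongly_soft s ->
  exists q : nat -> T, (forall n, strongly_soft (q n)) /\ (forall n, q n << s) /\
    increasing le q /\ is_sup le q s.
Proof.
  intros Hs. destruct (axO2 T s) as [xs [Hxs Hx]].
  destruct (dependent_choice (fun q => strongly_soft q /\ q << s)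
    (fun n q q' => q <= q' /\ xs n <= q') zero) as [q [_ [HQ Hstep]]].
  - split; [apply soft_zero | apply wb_zero].
  - intros n q [_ Hqs].
    assert (Hn : xs n << s) by (eapply wb_le_trans; [apply Hxs | apply Hx]).
    destruct (wb_join _ _ _ Hqs Hn) as [m [Hm [L1 L2]]].
    destruct (soft_interp m s Hs Hm) as [u [Hu [Hmu Hus]]].
    exists u. repeat split; auto; apply wb_le; eapply wb_trans; eauto.
  - exists q. repeat split.
    + intro n. apply HQ.
    + intro n. apply HQ.
    + intro n. apply Hstep.
    + intro n. apply wb_le, HQ.
    + intros u Hu. apply Hx. intro n. eapply le_trans; [apply Hstep | apply Hu].
Qed.

End SoftBelow.

(** * Functionals and the radius of comparison *)

Lemma Sup_seq_ub (u : nat -> Rbar) n : Rbar_le (u n) (Sup_seq u).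
Proof.
  apply (proj1 (is_sup_seq_lub _ _ (Sup_seq_correct u))). now exists n.
Qed.

Lemma Sup_seq_lub (u : nat -> Rbar) (l : Rbar) :
  (forall n, Rbar_le (u n) l) -> Rbar_le (Sup_seq u) l.
Proof.
  intros H. apply (proj2 (is_sup_seq_lub _ _ (Sup_seq_correct u))). intros y [n ->]. apply H.
Qed.

Lemma Rbar_plus_le_cancel_r (a b : Rbar) :
  Rbar_le (Finite 0) a -> Rbar_le (Finite 0) b ->
  Rbar_le (Rbar_plus a b) (Rbar_plus b b) -> Rbar_le a b.
Proof. destruct a as [a| |], b as [b| |]; simpl; try tauto. lra. Qed.

(** Passing from the soft part to the whole semigroup enlarges [r] by an arbitrarily small amount,
    which an infimum does not detect. *)
Lemma Glb_Rbar_eq_approx (E F : R -> Prop) :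
  (forall r, E r -> F r) -> (forall r r', F r -> r < r' -> E r') ->
  Glb_Rbar E = Glb_Rbar F.
Proof.
  intros HEF HFE.
  destruct (Glb_Rbar_correct E) as [LE GE]. destruct (Glb_Rbar_correct F) as [LF GF].
  apply Rbar_le_antisym.
  - apply GF. intros r Hr.
    assert (H : forall r', r < r' -> Rbar_le (Glb_Rbar E) (Finite r')) by (intros; apply LE; eauto).
    destruct (Glb_Rbar E) as [l| |]; simpl in *; auto.
    + apply Rnot_lt_le. intro Hl. specialize (H ((r + l) / 2)%R). lra.
    + apply (H (r + 1)%R). lra.
  - apply GE. intros r Hr. apply LF. auto.
Qed.

Section Functionals.
Context {T : CuSemigroup}.
Implicit Types x y z e w s : T.

(** From [s + w <= w + w] one copy of [lam w] cancels, also at infinity. Since [y] may lie outside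
    [P], soft elements can be compared through a nonsoft one. *)
Lemma functional_absorb (P : T -> Prop) lam s w y :
  functional P lam -> (forall x y, P x -> P y -> P (x + y)) -> P s -> P w ->
  s <= y -> y + w <= w + w -> Rbar_le (lam s) (lam w).
Proof.
  intros [_ [Hpos [Hadd [Hmon _]]]] HP Hs Hw Hle Habs.
  apply Rbar_plus_le_cancel_r; auto. rewrite <- !Hadd; auto. apply Hmon; auto.
  eapply le_trans; [apply add_le, Hle | exact Habs].
Qed.

Lemma functional_eq_absorb lam w e :
  functional allS lam -> w <= e -> e + w <= w + w -> lam w = lam e.
Proof.
  intros Hl Hwe Habs. apply Rbar_le_antisym.
  - apply Hl; unfold allS; auto.
  - apply (functional_absorb allS lam e w e); unfold allS; auto using le_refl.
Qed.

(** Soft elements are closed under increasing suprema, so a supremum within the soft part is one in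
    [T]. *)
Lemma functional_restrict lam : functional (@allS T) lam -> functional strongly_soft lam.
Proof.
  unfold allS. intros [H0 [Hpos [Hadd [Hmon Hsup]]]]. repeat split; auto.
  intros s z Hs Hi [Hz [Hub Hlub]]. apply Hsup; auto.
  repeat split; auto. intros u _ Hu.
  destruct (axO1 T s Hi) as [z' Hz'].
  apply le_trans with z'.
  - apply Hlub; [now apply (soft_sup s) | apply Hz'].
  - apply Hz'. exact Hu.
Qed.

Lemma functional_nmul lam n x (v : R) :
  functional allS lam -> lam x = Finite v -> lam (n ** x) = Finite (INR n * v).
Proof.
  intros [H0 [_ [Hadd _]]] Hv. induction n as [|n IH].
  - simpl. rewrite H0. f_equal. ring.
  - change (S n ** x) with (n ** x + x). rewrite Hadd, IH, Hv by exact I.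
    rewrite S_INR. simpl. f_equal. ring.
Qed.

Hypothesis Hdiv : two_omega_divisible T.
Hypothesis H5 : O5 T.
Hypothesis H6 : O6 T.
Hypothesis H7 : O7 T.

Lemma soft_below_choice :
  exists sigma : T -> T,
    forall x, strongly_soft (sigma x) /\ sigma x <= x /\ x + sigma x <= sigma x + sigma x.
Proof.
  exists (fun x => proj1_sig (constructive_indefinite_description _
                     (soft_below_exists Hdiv H5 H6 H7 x))).
  intro x. apply proj2_sig.
Qed.

(** The extension is [lam (sigma x)]; by [functional_absorb] it does not depend on which absorbing
    soft element below [x] is chosen. *)
Lemma functional_extend lam :
  functional strongly_soft lam ->
  exists hat, functional (@allS T) hat /\
    (forall s, strongly_soft s -> hat s = lam s) /\
    (forall y w, strongly_soft w -> w <= y -> y + w <= w + w -> hat y = lam w).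
Proof.
  intros Hl. pose proof Hl as [H0 [Hpos [Hadd [Hmon Hsup]]]].
  destruct soft_below_choice as [sigma Hsig].
  assert (Hcmp : forall s w y, strongly_soft s -> strongly_soft w -> s <= y ->
            y + w <= w + w -> Rbar_le (lam s) (lam w)).
  { intros. eapply functional_absorb; eauto using soft_add. }
  exists (fun x => lam (sigma x)). split; [| split].
  - repeat split.
    + replace (sigma zero) with (@zero T); auto.
      apply le_antisym; [apply zero_le | apply Hsig].
    + intros x _. apply Hpos, Hsig.
    + intros x y _ _. destruct (Hsig x) as [Sx [Lx Ax]]. destruct (Hsig y) as [Sy [Ly Ay]].
      destruct (Hsig (x + y)) as [Sxy [Lxy Axy]].
      rewrite <- Hadd by auto. apply Rbar_le_antisym.
      * apply (Hcmp _ _ (x + y)); auto using soft_add.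
        rewrite !(add_swap _ _ (sigma x)). now apply add_le2.
      * apply (Hcmp _ _ (x + y)); auto using soft_add, add_le2.
    + intros x y _ _ Hxy. apply (Hcmp _ _ y); try apply Hsig.
      eapply le_trans; [apply Hsig | exact Hxy].
    + intros s z _ Hi [_ [Hub Hlub]].
      assert (Hz : is_sup le s z) by (split; [exact Hub | intros u; now apply Hlub]).
      apply Rbar_le_antisym.
      (* [sigma] need not be monotone, so [sigma z] is approximated by soft [q k] way below [z];
         each lies under some [s n]. *)
      * destruct (Hsig z) as [Sz [Lz Az]].
        destruct (soft_approx_seq Hdiv H5 H6 H7 (sigma z) Sz) as [q [Sq [Wq [Iq Hq]]]].
        rewrite (Hsup q (sigma z)); auto.
        2:{ split; [exact Sz | split; [apply Hq | intros u _; apply Hq]]. }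
        apply Sup_seq_lub. intro k.
        destruct (Wq k s z Hi Hz Lz) as [n Hn].
        eapply Rbar_le_trans; [| apply (Sup_seq_ub _ n)].
        apply (Hcmp _ _ (s n)); auto; apply Hsig.
      * apply Sup_seq_lub. intro n. apply (Hcmp _ _ z); try apply Hsig.
        eapply le_trans; [apply Hsig | apply Hub].
  - intros s Hs. destruct (Hsig s) as [Ss [Ls As]]. apply Rbar_le_antisym; auto.
    apply (Hcmp _ _ s); auto using le_refl.
  - intros y w Hw Lw Aw. destruct (Hsig y) as [Ss [Ls As]].
    apply Rbar_le_antisym; apply (Hcmp _ _ y); auto.
Qed.

Lemma R1_soft_of_R1 w e r :
  (forall lam, functional allS lam -> lam w = lam e) -> R1 allS e r -> R1 strongly_soft w r.
Proof.
  intros Hw HR x y Hx Hy H. apply HR; try exact I. intros lam Hl.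
  rewrite <- (Hw lam Hl). apply H. now apply functional_restrict.
Qed.

(* For [x' << x] a small soft [v] with [(2 ^ j) v <= e] makes [x' + v] strongly soft, at the
   cost of replacing [r] by [r']. *)
Lemma R1_of_R1_soft w e r r' :
  full e -> w <= e -> strongly_soft w -> 0 < r -> r < r' ->
  R1 strongly_soft w r -> R1 allS e r'.
Proof.
  intros Hfull Hwe Hw Hr Hrr HR x y _ _ H. apply le_of_wb. intros x' Hx'.
  destruct (wb_interp _ _ Hx') as [x1 [Hx1 Hx2]].
  destruct (dominated_wb _ _ _ Hx1 (full_dominated _ _ _ Hfull Hx2)) as [e' [He' Hd]].
  (* With [2 ^ S j] above [1 / (r' - r)], the value of [v] is at most [(r' - r)] times that of [e],
     when the latter is finite. *)
  destruct (nfloor_ex (/ (r' - r))) as [j [_ Hj]].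
  { apply Rlt_le, Rinv_0_lt_compat. lra. }
  destruct (dyadic_division Hdiv (S j) e' e He') as [v0 [Hv0 Hdv0]].
  destruct (soft_below_exists Hdiv H5 H6 H7 v0) as [v [Sv [Lv Av]]].
  destruct (soft_below_exists Hdiv H5 H6 H7 y) as [u [Su [Lu Au]]].
  assert (Sxv : strongly_soft (x' + v)).
  { apply soft_add_absorb; auto. intros d Hdx.
    eapply le_dominated; [apply wb_le, Hdx|]. eapply dominated_trans; [exact Hd|].
    eapply dominated_trans; [exact Hdv0|]. now apply absorbing_dominates. }
  apply le_trans with (x' + v); [apply le_addr|]. apply le_trans with u; [| exact Lu].
  apply HR; auto. intros lam Hlam.
  destruct (functional_extend lam Hlam) as [hat [Hhat [Hsoft Habs]]].
  rewrite <- (Habs y u) by auto. rewrite <- !Hsoft by auto.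
  eapply Rbar_le_trans; [| apply (H hat Hhat)].
  pose proof Hhat as [_ [Hpos [Hadd [Hmon _]]]].
  rewrite Hadd by exact I.
  pose proof (Hmon x' x I I (wb_le _ _ Hx')) as Lx.
  pose proof (Hmon w e I I Hwe) as Lw.
  assert (Lkv : Rbar_le (hat ((2 ^ S j)%nat ** v)) (hat e)).
  { apply Hmon; try exact I. eapply le_trans; [| exact Hv0]. now apply nmul_le. }
  assert (Lv' : Rbar_le (hat v) (hat e)).
  { apply Hmon; try exact I. eapply le_trans; [| exact Hv0]. eapply le_trans; [exact Lv|].
    rewrite <- (nmul_one v0) at 1.
    apply (increasing_le (fun n => n ** v0)); [apply nmul_increasing|].
    apply Nat.le_succ_l, Nat.neq_0_lt_0, Nat.pow_nonzero. lia. }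
  pose proof (Hpos x I) as Px. pose proof (Hpos x' I) as Px'. pose proof (Hpos e I) as Pe.
  pose proof (Hpos v I) as Pv. pose proof (Hpos w I) as Pw.
  destruct (hat e) as [E| |] eqn:HE; try contradiction.
  - destruct (hat v) as [V| |] eqn:HV; try contradiction.
    destruct (hat w) as [W| |] eqn:HW; try contradiction.
    rewrite (functional_nmul hat _ _ V Hhat HV) in Lkv. cbn [Rbar_le] in *.
    assert (HK : / (r' - r) < INR (2 ^ S j)).
    { eapply Rlt_le_trans; [exact Hj|]. rewrite <- S_INR. apply le_INR.
      apply Nat.lt_le_incl, Nat.pow_gt_lin_r. lia. }
    assert (HV' : (V <= (r' - r) * E)%R).
    { apply Rmult_le_reg_l with (/ (r' - r))%R; [apply Rinv_0_lt_compat; lra|].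
      rewrite <- Rmult_assoc, Rinv_l, Rmult_1_l by lra.
      eapply Rle_trans; [| exact Lkv]. apply Rmult_le_compat_r; lra. }
    destruct (hat x') as [X'| |], (hat x) as [X| |]; simpl in *; try contradiction; auto.
    assert (r * W <= r * E)%R by (apply Rmult_le_compat_l; lra). lra.
  (* If [e] has infinite value, the right-hand side is infinite because [r'] is positive. *)
  - replace (Rbar_mult (Finite r') p_infty) with p_infty.
    + destruct (hat x) as [X| |]; simpl in *; try contradiction;
      destruct (Rbar_plus _ _); exact I.
    + symmetry. rewrite Rbar_mult_comm. apply is_Rbar_mult_unique, is_Rbar_mult_p_infty_pos.
      simpl. lra.
Qed.

Lemma rc_soft_eq w e :
  full e -> w <= e -> strongly_soft w ->
  (forall lam, functional allS lam -> lam w = lam e) ->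
  rc allS e = rc strongly_soft w.
Proof.
  intros Hfull Hwe Hw Hlam. apply Glb_Rbar_eq_approx.
  - intros r [Hr HR]. split; auto. now apply (R1_soft_of_R1 w e).
  - intros r r' [Hr HR] Hrr. split; [lra|]. now apply (R1_of_R1_soft w e r).
Qed.

End Functionals.

(** * The largest strongly soft element below a given element *)

Section LargestSoft.
Context {T : CuSemigroup}.
Hypothesis Hdiv : two_omega_divisible T.
Hypothesis H5 : O5 T.
Hypothesis H6 : O6 T.
Hypothesis H7 : O7 T.
Implicit Types a b d e p q u v w x z : T.

(* (O7) joins [q'] and [w'] to some [z <= a, q + w]; halving [z] to [h] and splitting [h] along
   [q + w] gives [q1 + w1 <= h + h <= a]. *)
Lemma disjoint_below a q q' w w' :
  q' << q -> q <= a -> w' << w -> w <= a ->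
  exists q1 w1, q1 <= q /\ w1 <= w /\ q1 + w1 <= a /\
    dominated q' (q1 + w1) /\ dominated w' (q1 + w1).
Proof.
  intros Hq Hqa Hw Hwa.
  destruct (H7 q' q w' w a) as [z [Hz1 [Hz2 [Hz3 Hz4]]]]; auto.
  destruct (wb_join _ _ _ Hz1 Hz2) as [z' [Hz' [L1 L2]]].
  destruct (wb_interp _ _ Hz') as [z2 [Hz'2 Hz2z]].
  destruct (halving Hdiv z2 z Hz2z) as [h [Hh Hdh]].
  destruct (dominated_wb _ _ _ Hz'2 Hdh) as [h' [Hh' Hdh']].
  assert (Hhz : h <= z) by (eapply le_trans; [apply le_addr | exact Hh]).
  destruct (H6 h' h q w) as [q1 [w1 [A1 [A2 [B1 [B2 C]]]]]]; auto.
  { eapply le_trans; eauto. }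
  assert (D : dominated z' (q1 + w1)) by (eapply dominated_le_trans; eauto).
  exists q1, w1. repeat split; auto.
  - eapply le_trans; [| exact Hz3]. eapply le_trans; [| exact Hh]. now apply add_le2.
  - eapply le_dominated; [apply wb_le, L1 | exact D].
  - eapply le_dominated; [apply wb_le, L2 | exact D].
Qed.

(** [q + w] may exceed [a] and [b]. Shrinking the pair to fit below [a], then shrinking the result
    to fit below [b], preserves the ideals up to way-below. *)
Lemma common_below a b q q' w w' :
  q' << q -> q <= a -> q <= b -> w' << w -> w <= a -> w <= b ->
  exists p, p <= a /\ p <= b /\ p <= q + w /\ dominated q' p /\ dominated w' p.
Proof.
  intros Hq Hqa Hqb Hw Hwa Hwb.
  destruct (wb_interp _ _ Hq) as [q0 [Hq0 Hq0q]].
  destruct (wb_interp _ _ Hw) as [w0 [Hw0 Hw0w]].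
  destruct (disjoint_below a q q0 w w0) as [q1 [w1 [Q1 [W1 [A [Dq Dw]]]]]]; auto.
  destruct (dominated_wb _ _ _ Hq0 Dq) as [y1 [Hy1 Dy1]].
  destruct (dominated_wb _ _ _ Hw0 Dw) as [y2 [Hy2 Dy2]].
  destruct (wb_join _ _ _ Hy1 Hy2) as [y [Hy [L1 L2]]].
  destruct (wb_add_split _ _ _ Hy) as [q1' [w1' [Hq1 [Hw1 Hy']]]].
  destruct (disjoint_below b q1 q1' w1 w1') as [q2 [w2 [Q2 [W2 [B [Eq Ew]]]]]]; auto.
  1,2: eapply le_trans; eauto.
  assert (D : dominated y (q2 + w2)).
  { eapply le_dominated; [apply wb_le, Hy'|]. now apply dominated_add. }
  assert (L : q2 + w2 <= q1 + w1) by now apply add_le2.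
  exists (q2 + w2). repeat split; auto.
  - eapply le_trans; eauto.
  - eapply le_trans; [exact L | now apply add_le2].
  - eapply dominated_trans; [exact Dy1|]. eapply le_dominated; [apply wb_le, L1 | exact D].
  - eapply dominated_trans; [exact Dy2|]. eapply le_dominated; [apply wb_le, L2 | exact D].
Qed.

(** The ideal of the common lower bound [p] is sandwiched between those of [d] and [v]. *)
Definition common_cover a b (v d : T) : Prop :=
  exists p, p <= a /\ p <= b /\ dominated p v /\ dominated d p.

(** (O6) splits [v] along [n ** c + c] and [common_below] merges the covers of the parts. [Phi]
    carries the bound by the other element through the induction. *)
Lemma common_cover_nmul (Phi : T -> Prop) a b c n :
  (forall v v', Phi v' -> v <= v' -> Phi v) ->
  (forall v d, v <= c -> Phi v -> d << v -> common_cover a b v d) ->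
  forall v d, v <= n ** c -> Phi v -> d << v -> common_cover a b v d.
Proof.
  intros HPhi Hc. induction n as [|n IH]; intros v d Hv Pv Hd.
  - apply (Hc v d); auto. eapply le_trans; [exact Hv | apply zero_le].
  - simpl in Hv. destruct (wb_interp _ _ Hd) as [d1 [Hd1 Hd1v]].
    destruct (H6 d1 v (n ** c) c Hd1v Hv) as [v1 [w1 [A1 [A2 [B1 [B2 C]]]]]].
    destruct (wb_add_split d v1 w1) as [v' [w' [Hv' [Hw' Hd']]]].
    { eapply wb_le_trans; eauto. }
    destruct (wb_interp _ _ Hv') as [v2 [Hv2 Hv2v]].
    destruct (wb_interp _ _ Hw') as [w2 [Hw2 Hw2w]].
    destruct (IH v1 v2) as [p1 [P1 [P2 [P3 P4]]]]; eauto.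
    destruct (Hc w1 w2) as [p2 [Q1 [Q2 [Q3 Q4]]]]; eauto.
    destruct (dominated_wb _ _ _ Hv2 P4) as [p1' [Hp1 D1]].
    destruct (dominated_wb _ _ _ Hw2 Q4) as [p2' [Hp2 D2]].
    destruct (common_below a b p1 p1' p2 p2') as [p [R1' [R2 [R3 [R4 R5]]]]]; auto.
    exists p. repeat split; auto.
    + eapply le_dominated; [exact R3|]. apply dominated_add.
      * eapply dominated_le_trans; eauto.
      * eapply dominated_le_trans; eauto.
    + eapply le_dominated; [apply wb_le, Hd'|].
      apply dominated_add; eapply dominated_trans; eauto.
Qed.

(** The bound by multiples of [a] is reduced to [v <= a], then likewise for [b]; at that point [v]
    itself is the common lower bound. *)
Lemma ideal_filtered a b v d :
  dominated v a -> dominated v b -> d << v -> common_cover a b v d.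
Proof.
  intros [n Ha] [m Hb] Hd.
  apply (common_cover_nmul (fun v => v <= m ** b) a b a n); auto.
  { intros; eapply le_trans; eauto. }
  clear v d Ha Hb Hd. intros v d Hva Hvb Hd.
  apply (common_cover_nmul (fun v => v <= a) a b b m); auto.
  { intros; eapply le_trans; eauto. }
  clear v d Hva Hvb Hd. intros v d Hvb Hva Hd.
  exists v. repeat split; auto; apply dominated_le; [apply le_refl | now apply wb_le].
Qed.

(** Replaces a soft element below [e] by one generating the ideal of [e], so that its gaps can be
    made large. *)
Lemma soft_full_above e u u' :
  strongly_soft u -> u <= e -> u' << u ->
  exists w, strongly_soft w /\ w <= e /\ u' << w /\ dominated e w.
Proof.
  intros Hu He Hu'. destruct (wb_interp _ _ Hu') as [u1 [H1 H2]].
  destruct (soft_below Hdiv H5 H6 H7 e u1) as [w [A [B [C D]]]].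
  { eapply soft_approx_of_soft; eauto. }
  exists w. repeat split; auto.
  - eapply wb_le_trans; eauto.
  - now apply absorbing_dominates.
Qed.

(** Choosing [z] above a part of [w] that dominates [d] forces the gap [t] over [z1] to dominate [d]
    too. *)
Lemma soft_gap_covering w u d d1 e :
  strongly_soft w -> w <= e -> dominated e w -> u << w -> d << d1 -> d1 <= e ->
  exists z z1 t, strongly_soft z /\ u << z /\ z << z1 /\ z1 + t <= e /\
    dominated d z /\ dominated d t.
Proof.
  intros Hw Hwe Hew Hu Hd Hd1.
  destruct (dominated_wb _ _ _ Hd (le_dominated _ _ _ Hd1 Hew)) as [w' [Hw' Dw']].
  destruct (wb_join _ _ _ Hu Hw') as [m [Hm [L1 L2]]].
  destruct (soft_interp Hdiv H5 H6 H7 m w Hw Hm) as [z [Sz [Hmz Hzw]]].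
  destruct (wb_interp _ _ Hzw) as [z1 [Hz1 Hz1w]].
  destruct (soft_gap w z1 Hw Hz1w) as [t [Ht Dt]].
  assert (Dz : dominated d z).
  { eapply dominated_le_trans; [exact Dw'|]. apply wb_le. eapply wb_trans; eauto. }
  exists z, z1, t. repeat split; auto.
  - eapply wb_trans; eauto.
  - eapply le_trans; [apply wb_le, Ht | exact Hwe].
  - eapply dominated_trans; [exact Dz|]. eapply le_dominated; [apply wb_le, Hz1 | exact Dt].
Qed.

Hypothesis Hsep : left_soft_separative T.

(* A common part [p] of the gaps [t1], [t2] is removed from [e], leaving [c]; then
   [z2 + p2 << e <= c + p2], and cancellation gives [z2 << c]. *)
Lemma soft_directed e u1 u2 u1' u2' :
  strongly_soft u1 -> u1 <= e -> u1' << u1 ->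
  strongly_soft u2 -> u2 <= e -> u2' << u2 ->
  exists w, strongly_soft w /\ w <= e /\ u1' << w /\ u2' << w.
Proof.
  intros S1 L1 W1 S2 L2 W2.
  destruct (soft_full_above e u1 u1') as [w1 [Sw1 [Lw1 [Uw1 Dw1]]]]; auto.
  destruct (soft_full_above e u2 u2') as [w2 [Sw2 [Lw2 [Uw2 Dw2]]]]; auto.
  destruct (wb_interp _ _ Uw1) as [v1 [Hv1 Hvw1]].
  destruct (wb_interp _ _ Uw2) as [v2 [Hv2 Hvw2]].
  destruct (wb_join v1 v2 e) as [d [Hde [Hd1 Hd2]]]; [eapply wb_le_trans; eauto .. |].
  destruct (wb_interp _ _ Hde) as [dh [Hdh Hdhe]].
  destruct (wb_interp _ _ Hdh) as [dm [Hdm Hdmh]].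
  destruct (wb_interp _ _ Hdhe) as [dt [Hdht Hdte]].
  destruct (soft_gap_covering w1 v1 dh dt e) as [z1 [z1h [t1 [Sz1 [Vz1 [Zz1 [Lz1 [Dz1 Dt1]]]]]]]];
    auto using wb_le.
  destruct (soft_gap_covering w2 v2 dh dt e) as [z2 [z2h [t2 [Sz2 [Vz2 [Zz2 [Lz2 [Dz2 Dt2]]]]]]]];
    auto using wb_le.
  destruct (ideal_filtered t1 t2 dh dm Dt1 Dt2 Hdmh) as [p [P1 [P2 [P3 P4]]]].
  destruct (dominated_wb _ _ _ Hdm P4) as [p1 [Hp1 Ddp1]].
  destruct (wb_interp _ _ Hp1) as [p2 [Hp12 Hp2p]].
  destruct (H5 p1 p2 z1 z1h e) as [c [Hc1 [Hc2 Hc3]]]; auto.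
  { rewrite add_comm. eapply le_trans; [| exact Lz1]. apply add_le2; [apply le_refl|].
    eapply le_trans; [apply wb_le, Hp2p | exact P1]. }
  assert (Hz2c : z2 << c).
  { apply (Hsep z2 c p2); auto.
    - eapply wb_le_trans; [exact (wb_add _ _ _ _ Zz2 Hp2p)|].
      eapply le_trans; [| rewrite add_comm; exact Hc3].
      eapply le_trans; [| exact Lz2]. apply add_le2; auto using le_refl.
    - eapply dominated_wb_infty; [exact Hp2p|]. eapply dominated_trans; eauto.
    - eapply dominated_wb_infty; [exact Hp2p|]. eapply dominated_trans; [exact P3|].
      eapply dominated_le_trans; [exact Dz1 | now apply wb_le]. }
  assert (Hv1c : v1 <= c) by (apply wb_le; eapply wb_trans; eauto).
  assert (Hv2c : v2 <= c) by (apply wb_le; eapply wb_trans; eauto).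
  (* The join [g] is below [c] and [v1 + v2], hence dominated by [p1]; as [p1 + c <= e], [p1] is a
     remainder for [g]. *)
  destruct (H7 u1' v1 u2' v2 c) as [g [G1 [G2 [G3 G4]]]]; auto.
  destruct (wb_join _ _ _ G1 G2) as [g' [Hg' [K1 K2]]].
  destruct (soft_below Hdiv H5 H6 H7 e g') as [w [A [B [C D]]]].
  { exists g, p1. repeat split; auto.
    - rewrite add_comm. eapply le_trans; [| exact Hc2]. apply add_le2; auto using le_refl.
    - eapply le_dominated; [exact G4|].
      apply dominated_add; (eapply le_dominated; [| exact Ddp1]); now apply wb_le. }
  exists w. repeat split; auto; eapply wb_le_trans; eauto.
Qed.

(** A soft chain takes in, one at a time, every basis element way below some soft element under [e];
    directedness provides each step. *)
Lemma largest_soft e :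
  countably_based T ->
  exists sigma, strongly_soft sigma /\ sigma <= e /\
    forall x, strongly_soft x -> x <= e -> x <= sigma.
Proof.
  intros [b Hb].
  pose (A := fun z => exists u, strongly_soft u /\ u <= e /\ z << u).
  assert (A0 : A zero).
  { exists zero. split; [apply soft_zero | split; [apply zero_le | apply wb_zero]]. }
  destruct (dependent_choice (fun z => strongly_soft z /\ A z)
    (fun n z z' => z <= z' /\ (A (b n) -> b n <= z')) zero) as [s [_ [HQ Hstep]]].
  - split; [apply soft_zero | exact A0].
  - intros n z [Sz [u [Su [Lu Wu]]]].
    (* [zero] stands in when [b n] is not to be taken in. *)
    assert (Hd : exists d, A d /\ (A (b n) -> b n <= d)).
    { destruct (classic (A (b n))) as [H|H]; [exists (b n) | exists zero]; split; auto.
      - intros _; apply le_refl.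
      - tauto. }
    destruct Hd as [d [[u2 [Su2 [Lu2 Wu2]]] Hbd]].
    destruct (soft_directed e u u2 z d) as [w [Sw [Lw [Z1 Z2]]]]; auto.
    destruct (wb_join _ _ _ Z1 Z2) as [m [Hm [M1 M2]]].
    destruct (soft_interp Hdiv H5 H6 H7 m w Sw Hm) as [z' [Sz' [Hmz Hzw]]].
    exists z'. split; [split; [exact Sz' | now exists w] | split].
    + apply wb_le. eapply wb_trans; eauto.
    + intros H. eapply le_trans; [exact (Hbd H)|]. apply wb_le. eapply wb_trans; eauto.
  - assert (Hi : increasing le s) by (intro n; apply Hstep).
    destruct (axO1 T s Hi) as [sigma Hs]. exists sigma. repeat split.
    + apply (soft_sup s); auto. intro n; apply HQ.
    + apply Hs. intro n. destruct (HQ n) as [_ [u [_ [Lu Wu]]]].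
      eapply le_trans; [apply wb_le, Wu | exact Lu].
    + intros x Sx Lx. apply le_of_wb. intros x' Hx'.
      destruct (wb_interp _ _ Hx') as [x1 [H1 H2]].
      destruct (Hb x1) as [k [Hk1 Hk2]].
      destruct (H1 (fun n => b (k n)) x1 Hk1 Hk2 (le_refl _ _)) as [n Hn].
      eapply le_trans; [exact Hn|].
      destruct (Hstep (k n)) as [_ H]. eapply le_trans; [| apply (proj1 Hs (S (k n)))].
      apply H. exists x. repeat split; auto. eapply le_wb; [apply Hk2 | exact H2].
Qed.

End LargestSoft.

Theorem theorem8p5 (S : CuSemigroup) (e : S) :
  two_omega_divisible S -> O5 S -> O6 S -> O7 S -> full e ->
  (exists w : S,
     strongly_soft w /\ le w e /\ le_infty e w /\
     (forall lam, functional allS lam -> lam w = lam e) /\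
     rc allS e = rc strongly_soft w) /\
  (countably_based S -> left_soft_separative S ->
     exists sigma_e : S,
       strongly_soft sigma_e /\ le sigma_e e /\
       (forall x : S, strongly_soft x -> le x e -> le x sigma_e) /\
       rc allS e = rc strongly_soft sigma_e).
Proof.
  intros Hdiv H5 H6 H7 Hfull.
  destruct (soft_below_exists Hdiv H5 H6 H7 e) as [w [Hw [Hwe Habs]]].
  assert (Hlam : forall lam, functional allS lam -> lam w = lam e).
  { intros lam Hl. now apply functional_eq_absorb. }
  split.
  - exists w. repeat split; auto.
    + destruct (infty_exists w) as [z Hz]. exists z. split; auto.
      destruct (absorbing_dominates e w Habs) as [n Hn].
      eapply le_trans; [exact Hn | apply Hz].
    + now apply rc_soft_eq.
  - intros Hcb Hsep.
    destruct (largest_soft Hdiv H5 H6 H7 Hsep e Hcb) as [sigma [Ss [Ls Hmax]]].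
    exists sigma. repeat split; auto. apply rc_soft_eq; auto.
    (* By maximality [w <= sigma <= e], and [lam] agrees on the two ends. *)
    intros lam Hl. pose proof Hl as [_ [_ [_ [Hmon _]]]]. apply Rbar_le_antisym.
    + now apply Hmon.
    + rewrite <- (Hlam lam Hl). apply Hmon; try exact I. now apply Hmax.
Qed.
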